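(* Let $f,g,h$ be real-valued measurable functions on $[a,b]$ such that neither $f(s)$ nor $g(s)$ equals $0$ for $s\in[a,b]$. Assume that $\frac hf$ and $\frac hg$ are Hölder continuous on $[a,b]$ of orders $p,q\in(0,1]$ with Hölder constants $H_1,H_2>0$, respectively. Let $\alpha>1$ and $\frac1\alpha+\frac1\beta=1$. Then: (i) if $f,g\in L^\infty[a,b]$, $$\left|\widehat{\mathcal{P}}_h(f,g)\right|\le H_1H_2\,\frac{(b-a)^{p+q+2}}{\sqrt{(2p+1)(2p+2)(2q+1)(2q+2)}}\,\|f\|_\infty^2\|g\|_\infty^2;$$ (ii) if $f,g\in L^{2\beta}[a,b]$, $$\left|\widehat{\mathcal{P}}_h(f,g)\right|\le H_1H_2\,\frac{2^{-1/\beta}(b-a)^{p+q+\frac2\alpha}}{\left[(2\alpha p+1)(2\alpha p+2)(2\alpha q+1)(2\alpha q+2)\right]^{\frac{1}{2\alpha}}}\,\|f\|_{2\beta}^2\|g\|_{2\beta}^2;$$ (iii) if $f,g\in L^2[a,b]$, $$\left|\widehat{\mathcal{P}}_h(f,g)\right|\le\frac12H_1H_2\,(b-a)^{p+q}\,\|f\|_2^2\|g\|_2^2.$$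
   Context: For real functions $f,g,h$ on $[a,b]$ ($a<b$), the (generalized Pompeiu–Chebyshev) functional is $$\widehat{\mathcal{P}}_h(f,g)=\int_a^b h^2(x)\,dx\int_a^b f(t)g(t)\,dt-\int_a^b f(t)h(t)\,dt\int_a^b h(x)g(x)\,dx.$$ $F$ is Hölder continuous of order $p$ with constant $H$ if $|F(x)-F(t)|\le H|x-t|^p$ for all $x,t\in[a,b]$. $\|f\|_\infty$ and $\|f\|_p=\left(\int_a^b|f(t)|^p\,dt\right)^{1/p}$ are the usual Lebesgue norms on $[a,b]$. *)

(* Defs.v *)
From HB Require Import structures.
From mathcomp Require Import all_boot all_order all_algebra.
From mathcomp Require Import all_classical all_reals all_analysis.
Set Implicit Arguments.
Unset Strict Implicit.
Unset Printing Implicit Defensive.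
Import Order.TTheory GRing.Theory Num.Theory.
Import numFieldNormedType.Exports.

Local Open Scope classical_set_scope.
Local Open Scope ring_scope.

(* The real line with the sigma-algebra of Lebesgue-measurable sets, which is
   the domain of [completed_lebesgue_measure]; [lebesgue_measure] and the
   default sigma-algebra on [R] are the Borel ones. *)
Notation lebesgueType R := (caratheodory_type (@wlength R idfun)^*%mu).
Notation leb := (@completed_lebesgue_measure _).

(* Functions on [a, b] are represented by total functions on R of which only
   the values on [a, b] matter. The codomain carries the Borel sigma-algebra. *)
Definition measurable_on (R : realType) (a b : R) (f : R -> R) : Prop :=
  measurable_fun (`[a, b] : set (lebesgueType R)) (f : lebesgueType R -> R).

(* The extension by zero [f \_ `[a, b]] has the same L^p norm on R as [f] has
   on [a, b], for every exponent, including +oo. *)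
Definition in_Lp (R : realType) (a b : R) (p : \bar R) (f : R -> R) : Prop :=
  (f \_ `[a, b] : lebesgueType R -> R) \in Lfun leb p.

Definition norm_Lp (R : realType) (a b : R) (p : \bar R) (f : R -> R) : R :=
  fine ('N[leb]_p[EFin \o (f \_ `[a, b])])%E.

Definition holder_on (R : realType) (a b p H : R) (F : R -> R) : Prop :=
  forall x t, x \in `[a, b] -> t \in `[a, b] ->
    `|F x - F t| <= H * `|x - t| `^ p.

Definition pompeiu_chebyshev (R : realType) (a b : R) (h f g : R -> R) : R :=
  (\int[leb]_(x in `[a, b]) (h x ^+ 2)) *
  (\int[leb]_(t in `[a, b]) (f t * g t)) -
  (\int[leb]_(t in `[a, b]) (f t * h t)) *
  (\int[leb]_(x in `[a, b]) (h x * g x)).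

(* Main.v *)
Require Import Defs.
From HB Require Import structures.
From mathcomp Require Import all_boot all_order all_algebra.
From mathcomp Require Import all_classical all_reals all_analysis.
From mathcomp Require Import measurable_realfun ess_sup_inf ring lra.
Set Implicit Arguments.
Unset Strict Implicit.
Unset Printing Implicit Defensive.
Import Order.TTheory GRing.Theory Num.Theory.
Import numFieldNormedType.Exports.
Local Open Scope classical_set_scope.
Local Open Scope ring_scope.

(** The proof rests on Korkine's identity: with
      Delta x t = (h x * f t - h t * f x) * (h x * g t - h t * g x),
    twice the functional is the integral over x of the integral over t of
    Delta x t.  Since Delta is a finite sum of products of a function of x and
    a function of t, the identity follows from linearity of the integral
    alone (korkine_identity).

    As f and g do not vanish,
      Delta x t = f x f t (h x / f x - h t / f t)
                  * g x g t (h x / g x - h t / g t),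
    so the Hoelder conditions on h / f and h / g give
      |Delta x t| <= |f x g x| * H1 * H2 * |x - t| ^ s * |f t g t|, s = p + q
    (holder_ratio_kernel).  It remains to bound the quadratic form with kernel
    |x - t| ^ s at the function |f g|.

    For (iii), |x - t| ^ s <= (b - a) ^ s, and the form is at most that
    constant times the square of the L^1 norm of f g, which Cauchy-Schwarz
    bounds.  For (i) and (ii), Hoelder's inequality with exponents alpha and
    beta (1 and +oo in case (i)) is applied first in t and then in x
    (korkine_hoelder_bound).  The inner step produces the explicit potential
      J x = ((x - a) ^ (r + 1) + (b - x) ^ (r + 1)) / (r + 1), r = alpha * s,
    the outer one its integral
      2 * (b - a) ^ (r + 2) / ((r + 1) * (r + 2)).
    The norm of f g in L^beta is at most the product of the norms of f and g
    in L^(2 beta) by Cauchy-Schwarz (Lnorm_mul_le).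

    This gives a constant containing (r + 1) * (r + 2), which is at least
    as good as the claimed geometric mean of its analogues with s replaced by
    2 p and 2 q: by the AM-GM inequality (holder_constant_le),
      (2 u + 1) (2 u + 2) (2 v + 1) (2 v + 2) <= ((u + v + 1) (u + v + 2)) ^ 2.

    All integrals split by linearity converge: f and g are square integrable
    in each of the three cases because the interval has finite measure, and so
    is h, since the Hoelder function h / f is bounded. *)

(** * Lebesgue and Borel measurability on the line *)

Lemma borel_lebesgue_measurable (R : realType) (A : set R) :
  measurable A -> measurable (A : set (lebesgueType R)).
Proof. exact: sub_caratheodory. Qed.

Lemma measurable_fun_lebesgue (R : realType) d (Y : measurableType d)
    (A : set R) (f : R -> Y) :
  measurable A -> measurable_fun A f ->
  measurable_fun (A : set (lebesgueType R)) (f : lebesgueType R -> Y).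
Proof.
by move=> mA mf _ B mB; apply: borel_lebesgue_measurable; exact: mf.
Qed.

(** The fundamental theorem of calculus speaks of the Borel measure; this
    transfers its results to the completed one, the identity pushing the latter
    forward to the former. *)
Lemma ge0_integral_leb_borel (R : realType) (A : set R) (f : R -> \bar R) :
  measurable A -> measurable_fun A f -> (forall x, A x -> 0 <= f x)%E ->
  (\int[leb]_(x in (A : set (lebesgueType R))) (f : lebesgueType R -> _) x =
   \int[@lebesgue_measure R]_(x in A) f x)%E.
Proof.
move=> mA mf f0.
have mid : measurable_fun setT (idfun : lebesgueType R -> measurableTypeR R).
  by apply: measurable_fun_lebesgue; [exact: measurableT|exact: measurable_id].
have := @ge0_integral_pushforward _ _ (lebesgueType R) (measurableTypeR R) R
  _ mid leb A f mA mf.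
rewrite /preimage/= => <-; last by move=> y; rewrite inE => /f0.
exact: eq_measure_integral.
Qed.

(** * Integrals of powers of the distance to a point *)

(** [powR] takes the value 1 at negative bases, so that it is not continuous at
    0; composing it with the absolute value repairs this. *)
Lemma continuous_norm_powR (R : realType) (r : R) : 0 < r ->
  continuous (fun x : R => `|x| `^ r).
Proof.
move=> r0 x; have [->|x0] := eqVneq x 0.
  apply/cvgrPdist_lt => e e0; rewrite normr0 powR0 ?gt_eqF//.
  near=> t; rewrite sub0r normrN ger0_norm ?powR_ge0//.
  (* |t| ^ r < e as soon as |t| < e ^ (1 / r). *)
  have -> : e = (e `^ r^-1) `^ r.
    by rewrite -powRrM mulVf ?gt_eqF// powRr1// ltW.
  rewrite gt0_ltr_powR ?nnegrE ?powR_ge0//.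
  by near: t; apply: (@nbhs0_lt R R); rewrite powR_gt0.
have nx0 : 0 < `|x| by rewrite normr_gt0.
apply: (@continuous_comp _ _ _ (@Num.norm R R) (fun y : R => y `^ r)).
  exact: norm_continuous.
apply: differentiable_continuous; apply/derivable1_diffP.
exact: (@ex_derive _ _ _ _ _ _ _ (is_derive1_powR r nx0)).
Unshelve. all: by end_near. Qed.

Lemma continuous_dist_powR (R : realType) (c r : R) : 0 < r ->
  continuous (fun t : R => `|t - c| `^ r).
Proof.
move=> r0 t.
apply: (@continuous_comp _ _ _ (fun t => t - c) (fun y : R => `|y| `^ r)).
  by apply: cvgB; [exact: cvg_id|exact: cvg_cst].
exact: continuous_norm_powR.
Qed.

(** On either side of [c] the absolute value resolves with a fixed sign in a
    whole neighbourhood, which reduces the derivative to that of [powR] at a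
    positive base. *)
Lemma is_derive_dist_powR_right (R : realType) (c t r : R) : c < t ->
  is_derive t 1 (fun t : R => `|t - c| `^ r) (r * (t - c) `^ (r - 1)).
Proof.
move=> ct.
apply: (@near_eq_is_derive _ _ _ ((fun y : R => y `^ r) \o (fun t => t - c))).
  near=> u => /=; rewrite gtr0_norm// subr_gt0; near: u.
  exact: lt_nbhsr.
rewrite -[X in is_derive _ _ _ X]mulr1; apply: is_derive1_comp.
  by apply: is_derive1_powR; rewrite subr_gt0.
by rewrite -[X in is_derive _ _ _ X]subr0; apply: is_deriveB.
Unshelve. all: by end_near. Qed.

Lemma is_derive_dist_powR_left (R : realType) (c t r : R) : t < c ->
  is_derive t 1 (fun t : R => `|t - c| `^ r) (- (r * (c - t) `^ (r - 1))).
Proof.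
move=> tc.
apply: (@near_eq_is_derive _ _ _ ((fun y : R => y `^ r) \o (fun t => c - t))).
  near=> u => /=; rewrite distrC gtr0_norm// subr_gt0; near: u.
  exact: lt_nbhsl.
rewrite -[X in is_derive _ _ _ X]mulrN1; apply: is_derive1_comp.
  by apply: is_derive1_powR; rewrite subr_gt0.
by rewrite -[X in is_derive _ _ _ X]sub0r; apply: is_deriveB.
Unshelve. all: by end_near. Qed.

Lemma integral_dist_powR_right (R : realType) (c d r : R) : c <= d -> 0 < r ->
  (\int[@lebesgue_measure R]_(t in `[c, d]) (`|t - c| `^ r)%:E =
   ((d - c) `^ (r + 1) / (r + 1))%:E)%E.
Proof.
rewrite le_eqVlt => /predU1P[->|cd] r0; have r1 : 0 < r + 1 by lra.
  by rewrite set_itv1 integral_set1 subrr powR0 ?gt_eqF// mul0r.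
pose F (t : R) := (r + 1)^-1 * `|t - c| `^ (r + 1).
have cF : continuous F.
  by move=> t; apply: cvgM; [exact: cvg_cst|exact: continuous_dist_powR].
have dF t : t \in `]c, d[ -> is_derive t 1 F (`|t - c| `^ r).
  rewrite in_itv/= => /andP[ct _].
  have := @is_deriveZ _ _ _ _ (r + 1)^-1 _ _ _
    (is_derive_dist_powR_right (r + 1) ct).
  rewrite addrK gtr0_norm ?subr_gt0// scalerA mulVf ?gt_eqF// scale1r.
  exact.
rewrite (@continuous_FTC2 _ _ F)//.
- rewrite /F subrr normr0 powR0 ?gt_eqF// mulr0 sube0 gtr0_norm ?subr_gt0//.
  by rewrite mulrC.
- by apply: continuous_subspaceT => t; exact: continuous_dist_powR.
- split.
  + by move=> t /dF[].
  + exact/cvg_at_right_filter/cF.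
  + exact/cvg_at_left_filter/cF.
- by move=> t /dF[_]; rewrite derive1E.
Qed.

Lemma integral_dist_powR_left (R : realType) (c d r : R) : c <= d -> 0 < r ->
  (\int[@lebesgue_measure R]_(t in `[c, d]) (`|t - d| `^ r)%:E =
   ((d - c) `^ (r + 1) / (r + 1))%:E)%E.
Proof.
rewrite le_eqVlt => /predU1P[->|cd] r0; have r1 : 0 < r + 1 by lra.
  by rewrite set_itv1 integral_set1 subrr powR0 ?gt_eqF// mul0r.
pose F (t : R) := - (r + 1)^-1 * `|t - d| `^ (r + 1).
have cF : continuous F.
  by move=> t; apply: cvgM; [exact: cvg_cst|exact: continuous_dist_powR].
have dF t : t \in `]c, d[ -> is_derive t 1 F (`|t - d| `^ r).
  rewrite in_itv/= => /andP[_ td].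
  have := @is_deriveZ _ _ _ _ (- (r + 1)^-1) _ _ _
    (is_derive_dist_powR_left (r + 1) td).
  rewrite addrK distrC gtr0_norm ?subr_gt0// scalerN scaleNr opprK.
  rewrite scalerA mulVf ?gt_eqF// scale1r.
  exact.
rewrite (@continuous_FTC2 _ _ F)//.
- rewrite /F subrr normr0 powR0 ?gt_eqF// mulr0 distrC gtr0_norm ?subr_gt0//.
  by rewrite -EFinB sub0r mulNr opprK mulrC.
- by apply: continuous_subspaceT => t; exact: continuous_dist_powR.
- split.
  + by move=> t /dF[].
  + exact/cvg_at_right_filter/cF.
  + exact/cvg_at_left_filter/cF.
- by move=> t /dF[_]; rewrite derive1E.
Qed.

Lemma measurable_dist_powR (R : realType) (c r : R) (A : set R) :
  measurable_fun A (fun t : R => `|t - c| `^ r).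
Proof.
apply: measurable_funTS.
apply: (measurableT_comp (measurable_powR r)).
by apply: measurableT_comp => //; exact: measurable_funB.
Qed.

(** The absolute value is resolved by cutting the interval at [x]; each half is
    a power of the distance to one of its end points. *)
Lemma integral_dist_powR (R : realType) (a b x r : R) : a <= x <= b -> 0 < r ->
  (\int[leb]_(t in (`[a, b] : set (lebesgueType R))) (`|x - t| `^ r)%:E =
   (((x - a) `^ (r + 1) + (b - x) `^ (r + 1)) / (r + 1))%:E)%E.
Proof.
move=> /andP[ax xb] r0.
under eq_integral do rewrite distrC.
have mf (A : set R) : measurable_fun A (fun t : R => (`|t - x| `^ r)%:E).
  by apply/measurable_EFinP; exact: measurable_dist_powR.
have f0 t : (0 <= (`|t - x| `^ r)%:E)%E by rewrite lee_fin powR_ge0.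
rewrite (@ge0_integral_leb_borel _ _ (fun t => (`|t - x| `^ r)%:E))//.
rewrite (@itv_bndbnd_setU _ _ (BLeft a) (BLeft x)) ?bnd_simp//.
rewrite ge0_integral_setU//=; [|exact: mf|]; last first.
  apply/disj_setPS => t [/=]; rewrite !in_itv/= => /andP[_ tx] /andP[].
  by rewrite leNgt tx.
rewrite integral_itv_bndo_bndc// integral_dist_powR_left//.
by rewrite integral_dist_powR_right// -EFinD -mulrDl.
Qed.

Lemma integral2_dist_powR (R : realType) (a b r : R) : a <= b -> 0 < r ->
  (\int[leb]_(x in (`[a, b] : set (lebesgueType R)))
     (((x - a) `^ (r + 1) + (b - x) `^ (r + 1)) / (r + 1))%:E =
   (2 * (b - a) `^ (r + 2) / ((r + 1) * (r + 2)))%:E)%E.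
Proof.
move=> ab r0.
have r1 : 0 < r + 1 by lra.
pose h (c x : R) := (`|x - c| `^ (r + 1))%:E.
have mh c (A : set R) : measurable_fun A (h c).
  by apply/measurable_EFinP; exact: measurable_dist_powR.
have h0 c t : (0 <= h c t)%E by rewrite lee_fin powR_ge0.
pose g (x : R) := ((r + 1)^-1%:E * (h a x + h b x))%E.
transitivity (\int[leb]_(x in (`[a, b] : set (lebesgueType R))) g x)%E.
  apply: eq_integral => x; rewrite inE/= in_itv/= => /andP[ax xb].
  rewrite /g /h -EFinD -EFinM mulrC ger0_norm ?subr_ge0// distrC.
  by rewrite ger0_norm ?subr_ge0.
have r1V : (0 <= (r + 1)^-1%:E)%E by rewrite lee_fin invr_ge0 ltW.
rewrite (@ge0_integral_leb_borel _ _ g)//; last 2 first.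
- apply: emeasurable_funM; first exact: measurable_cst.
  by apply: emeasurable_funD; exact: mh.
- by move=> x _; rewrite mule_ge0// adde_ge0.
rewrite ge0_integralZl//; last 2 first.
- by apply: emeasurable_funD; exact: mh.
- by move=> x _; rewrite adde_ge0.
rewrite ge0_integralD//; [|exact: mh..].
rewrite integral_dist_powR_left// integral_dist_powR_right//.
rewrite -EFinD -EFinM; congr EFin.
have -> : r + 1 + 1 = r + 2 by lra.
by field; apply/andP; split; lra.
Qed.

(** * Korkine's identity and kernel bounds *)

Lemma integrable_fun_measurable d (T : measurableType d) (R : realType)
    (mu : {measure set T -> \bar R}) (D : set T) (u : T -> R) :
  mu.-integrable D (EFin \o u) -> measurable_fun D u.
Proof. by move=> /integrableP[/measurable_EFinP]. Qed.

(** Only linearity and monotonicity of the integral matter up to the kernel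
    estimates, which is why the measure space is arbitrary here. *)
Section korkine.
Context d (T : measurableType d) (R : realType).
Variables (mu : {measure set T -> \bar R}) (D : set T) (mD : measurable D).
Variables (f g h : T -> R).
Hypothesis ifg : mu.-integrable D (EFin \o (fun t => f t * g t)).
Hypothesis ifh : mu.-integrable D (EFin \o (fun t => f t * h t)).
Hypothesis ihg : mu.-integrable D (EFin \o (fun t => h t * g t)).
Hypothesis ihh : mu.-integrable D (EFin \o (fun t => h t ^+ 2)).

Let P := (\int[mu]_(x in D) (h x ^+ 2)) * (\int[mu]_(t in D) (f t * g t)) -
  (\int[mu]_(t in D) (f t * h t)) * (\int[mu]_(x in D) (h x * g x)).

Let Delta x t := (h x * f t - h t * f x) * (h x * g t - h t * g x).

Let DeltaE x : Delta x = (fun t =>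
  (h x ^+ 2 * (f t * g t) + f x * g x * h t ^+ 2) -
  (h x * g x * (f t * h t) + f x * h x * (h t * g t))).
Proof. by apply/funext => t; rewrite /Delta; ring. Qed.

Let integrableZ (c : R) (u : T -> R) : mu.-integrable D (EFin \o u) ->
  mu.-integrable D (EFin \o (fun t => c * u t)).
Proof. by move=> iu; exact: (integrableZl mD c iu). Qed.

Let integrable2 (u v : T -> R) (c e : R) : mu.-integrable D (EFin \o u) ->
  mu.-integrable D (EFin \o v) ->
  mu.-integrable D (EFin \o (fun t => c * u t + e * v t)).
Proof.
move=> iu iv.
exact: (integrableD mD (integrableZ c iu) (integrableZ e iv)).
Qed.

Let Rintegral2 (u v : T -> R) (c e : R) : mu.-integrable D (EFin \o u) ->
  mu.-integrable D (EFin \o v) ->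
  \int[mu]_(t in D) (c * u t + e * v t) =
  c * \int[mu]_(t in D) u t + e * \int[mu]_(t in D) v t.
Proof.
move=> iu iv; rewrite RintegralD//; [|exact: integrableZ..].
by rewrite !RintegralZl.
Qed.

Let integrable_Delta x : mu.-integrable D (EFin \o Delta x).
Proof.
rewrite DeltaE.
exact: (integrableB mD (integrable2 _ _ ifg ihh) (integrable2 _ _ ifh ihg)).
Qed.

Let phi x := \int[mu]_(t in D) Delta x t.

Let phiE : phi = (fun x =>
  (\int[mu]_(t in D) (f t * g t) * h x ^+ 2 +
   \int[mu]_(t in D) (h t ^+ 2) * (f x * g x)) -
  (\int[mu]_(t in D) (f t * h t) * (h x * g x) +
   \int[mu]_(t in D) (h t * g t) * (f x * h x))).
Proof.
apply/funext => x; rewrite /phi DeltaE RintegralB//; [|exact: integrable2..].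
by rewrite !Rintegral2//; ring.
Qed.

Let integrable_phi : mu.-integrable D (EFin \o phi).
Proof.
rewrite phiE.
exact: (integrableB mD (integrable2 _ _ ihh ifg) (integrable2 _ _ ihg ifh)).
Qed.

Lemma korkine_identity : \int[mu]_(x in D) phi x = 2 * P.
Proof.
rewrite phiE RintegralB//; [|exact: integrable2..].
by rewrite !Rintegral2// /P; ring.
Qed.

Let mfg : measurable_fun D (fun t => `|f t * g t|).
Proof. exact/measurableT_comp/(integrable_fun_measurable ifg). Qed.

(** The general scheme: a kernel estimate of [Delta] together with a bound [B]
    of the inner integral.  In the extended reals the integral on the right
    makes sense even when it diverges. *)
Lemma korkine_bound (k : T -> T -> R) (B : T -> R) :
  (forall x t, D x -> D t -> 0 <= k x t) ->
  (forall x, D x -> measurable_fun D (k x)) ->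
  (forall x t, D x -> D t ->
    `|Delta x t| <= `|f x * g x| * (k x t * `|f t * g t|)) ->
  measurable_fun D B ->
  (forall x, D x ->
    (\int[mu]_(t in D) (k x t * `|f t * g t|)%:E <= (B x)%:E)%E) ->
  ((2 * `|P|)%:E <= \int[mu]_(x in D) (B x * `|f x * g x|)%:E)%E.
Proof.
move=> k0 mk Dk mB kB.
have phiB x : D x -> (`|phi x|%:E <= (B x * `|f x * g x|)%:E)%E.
  move=> Dx; rewrite EFin_normr_Rintegral//.
  apply: (le_trans (le_abse_integral _ _ _)) => //.
    by case/integrableP : (integrable_Delta x).
  apply: (@le_trans _ _
      (\int[mu]_(t in D) (`|f x * g x|%:E * (k x t * `|f t * g t|)%:E))%E).
    apply: ge0_le_integral => //.
    - apply: measurableT_comp => //.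
      by case/integrableP : (integrable_Delta x).
    - apply/measurable_EFinP; apply: measurable_funM => //.
      by apply: measurable_funM => //; exact: mk.
    - by move=> t Dt; rewrite lee_fin; exact: Dk.
  rewrite ge0_integralZl_EFin//.
  - by rewrite [(B x * _)%R]mulrC EFinM lee_wpmul2l// ?lee_fin// kB.
  - by move=> t Dt; rewrite lee_fin mulr_ge0// k0.
  - by apply/measurable_EFinP; apply: measurable_funM => //; exact: mk.
rewrite -[2]ger0_norm// -normrM -korkine_identity EFin_normr_Rintegral//.
apply: (le_trans (le_abse_integral _ _ _)) => //.
  by case/integrableP : integrable_phi.
apply: ge0_le_integral => //.
- by apply: measurableT_comp => //; case/integrableP : integrable_phi.
- by apply/measurable_EFinP; exact: measurable_funM.
Qed.

(** Hoelder's inequality enters as a hypothesis on the pairing with [|f g|], in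
    which [W] stands for the norm of [f g] in the exponent dual to [al].
    Conjugate exponents and the limiting pair 1, +oo are thereby treated at
    once.  The hypothesis is used for the kernel [k x] and then for the
    potential [J ^ (1 / al)]. *)
Lemma korkine_hoelder_bound (k : T -> T -> R) (J : T -> R) (C al W : R) :
  0 <= C -> 0 < al -> 0 <= W ->
  (forall x t, D x -> D t -> 0 <= k x t) ->
  (forall x, D x -> measurable_fun D (k x)) ->
  (forall x t, D x -> D t ->
    `|Delta x t| <= `|f x * g x| * (C * k x t * `|f t * g t|)) ->
  measurable_fun D J -> (forall x, D x -> 0 <= J x) ->
  (forall x, D x -> (\int[mu]_(t in D) (k x t `^ al)%:E <= (J x)%:E)%E) ->
  (forall u : T -> R, measurable_fun D u -> (forall x, D x -> 0 <= u x) ->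
    (\int[mu]_(x in D) (u x * `|f x * g x|)%:E <=
     (\int[mu]_(x in D) (u x `^ al)%:E) `^ al^-1 * W%:E)%E) ->
  ((2 * `|P|)%:E <=
   (C * W)%:E * ((\int[mu]_(x in D) (J x)%:E) `^ al^-1 * W%:E))%E.
Proof.
move=> C0 al0 W0 k0 mk Dk mJ J0 kJ hol.
have alV : 0 <= al^-1 by rewrite invr_ge0 ltW.
have mJr : measurable_fun D (fun x => J x `^ al^-1).
  exact: (measurableT_comp (measurable_powR _)).
have inner x : D x -> (\int[mu]_(t in D) (C * k x t * `|f t * g t|)%:E <=
    (C * W * J x `^ al^-1)%:E)%E.
  move=> Dx; under eq_integral do rewrite -mulrA EFinM.
  rewrite ge0_integralZl_EFin//; last 2 first.
  - by move=> t Dt; rewrite lee_fin mulr_ge0// k0.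
  - by apply/measurable_EFinP; apply: measurable_funM => //; exact: mk.
  rewrite -mulrA EFinM lee_wpmul2l ?lee_fin//.
  apply: (le_trans (hol _ (mk _ Dx) (k0 _ ^~ Dx))).
  rewrite mulrC EFinM lee_wpmul2r ?lee_fin// -poweR_EFin gt0_ler_poweR//.
  - rewrite in_itv/= leey andbT integral_ge0// => t _.
    by rewrite lee_fin powR_ge0.
  - by rewrite in_itv/= leey andbT lee_fin J0.
  - exact: kJ.
have Ck0 x t : D x -> D t -> 0 <= C * k x t by move=> *; rewrite mulr_ge0// k0.
apply: (le_trans (korkine_bound Ck0 _ Dk _ inner)).
- by move=> x Dx; apply: measurable_funM => //; exact: mk.
- exact: measurable_funM.
under eq_integral do rewrite -mulrA EFinM.
rewrite ge0_integralZl_EFin//; last 3 first.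
- by move=> x _; rewrite lee_fin mulr_ge0// powR_ge0.
- by apply/measurable_EFinP; exact: measurable_funM.
- by rewrite mulr_ge0.
rewrite lee_wpmul2l ?lee_fin ?mulr_ge0//.
have JrK : (\int[mu]_(x in D) ((J x `^ al^-1) `^ al)%:E =
    \int[mu]_(x in D) (J x)%:E)%E.
  apply: eq_integral => x /[!inE] Dx.
  by rewrite -powRrM mulVf ?gt_eqF// powRr1// J0.
by rewrite -JrK; apply: hol => // x _; exact: powR_ge0.
Qed.

(** The counterpart of the previous estimate for a bounded kernel, where the
    relevant norm of [f g] is the L^1 norm. *)
Lemma korkine_sup_bound (k : T -> T -> R) (C K W : R) :
  0 <= C ->
  (forall x t, D x -> D t -> 0 <= k x t <= K) ->
  (forall x, D x -> measurable_fun D (k x)) ->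
  (forall x t, D x -> D t ->
    `|Delta x t| <= `|f x * g x| * (C * k x t * `|f t * g t|)) ->
  (\int[mu]_(x in D) `|f x * g x|%:E <= W%:E)%E ->
  0 <= W -> 0 <= K ->
  2 * `|P| <= C * K * W ^+ 2.
Proof.
move=> C0 k0 mk Dk fgW W0 K0.
have inner x : D x -> (\int[mu]_(t in D) (C * k x t * `|f t * g t|)%:E <=
    (C * K * W)%:E)%E.
  move=> Dx.
  apply: (@le_trans _ _ (\int[mu]_(t in D) (C * K * `|f t * g t|)%:E)%E).
    apply: ge0_le_integral => //.
    - by move=> t Dt; rewrite lee_fin !mulr_ge0//; case/andP: (k0 _ _ Dx Dt).
    - apply/measurable_EFinP; apply: measurable_funM => //.
      by apply: measurable_funM => //; exact: mk.
    - by apply/measurable_EFinP; exact: measurable_funM.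
    - move=> t Dt; rewrite lee_fin ler_wpM2r// ler_wpM2l//.
      by case/andP: (k0 _ _ Dx Dt).
  under eq_integral do rewrite EFinM.
  rewrite ge0_integralZl_EFin//; last 2 first.
  - exact/measurable_EFinP.
  - by rewrite mulr_ge0.
  by rewrite [leRHS]EFinM lee_wpmul2l// ?lee_fin ?mulr_ge0.
have Ck0 x t : D x -> D t -> 0 <= C * k x t.
  by move=> Dx Dt; rewrite mulr_ge0//; case/andP: (k0 _ _ Dx Dt).
rewrite -lee_fin; apply: (le_trans (korkine_bound Ck0 _ Dk _ inner)).
- by move=> x Dx; apply: measurable_funM => //; exact: mk.
- exact: measurable_cst.
under eq_integral do rewrite EFinM.
rewrite ge0_integralZl_EFin//; last 2 first.
- exact/measurable_EFinP.
- by rewrite !mulr_ge0.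
by rewrite expr2 mulrA [leRHS]EFinM lee_wpmul2l// ?lee_fin ?mulr_ge0// mulr_ge0.
Qed.

End korkine.

(** * Hoelder's inequality on a set *)

Section hoelder_on_a_set.
Context d (T : measurableType d) (R : realType).
Variable mu : {measure set T -> \bar R}.

(** Cauchy-Schwarz applied to [|F| ^ b] and [|G| ^ b], followed by a [b]-th
    root. *)
Lemma Lnorm_mul_le (F G : T -> R) (b : R) : 0 < b ->
  measurable_fun setT F -> measurable_fun setT G ->
  ('N[mu]_(b%:E)[EFin \o (F \* G)%R] <=
   'N[mu]_((2 * b)%:E)[EFin \o F] * 'N[mu]_((2 * b)%:E)[EFin \o G])%E.
Proof.
move=> b0 mF mG.
have mpow (K : T -> R) : measurable_fun setT K ->
    measurable_fun setT (fun x => `|K x| `^ b).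
  move=> mK; apply: (measurableT_comp (measurable_powR b)).
  exact: measurableT_comp.
have two : (2^-1 + 2^-1 = 1 :> R) by lra.
have N2 (K : T -> R) : ('N[mu]_(2%:E)[EFin \o (fun x => `|K x| `^ b)%R] =
    'N[mu]_((2 * b)%:E)[EFin \o K] `^ b)%E.
  rewrite unlock -poweRrM.
  have -> : (2 * b)^-1 * b = 2^-1 by field; rewrite gt_eqF.
  apply: (congr1 (poweR^~ _)); apply: eq_integral => x _ /=.
  by rewrite ger0_norm ?powR_ge0// -powRrM mulrC.
have := hoelder mu (mpow _ mF) (mpow _ mG) (ltr0n R 2) (ltr0n R 2) two.
rewrite !N2 Lnorm1 -poweRM ?Lnorm_ge0// => le_b.
have bV : 0 <= b^-1 by rewrite invr_ge0 ltW.
have := gt0_ler_poweR bV _ _ le_b.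
rewrite -poweRrM divff ?gt_eqF// poweRe1 ?mule_ge0 ?Lnorm_ge0//.
move=> /(_ _ _)/(le_trans _); apply; last 2 first.
- by rewrite in_itv/= leey andbT integral_ge0.
- by rewrite in_itv/= leey andbT poweR_ge0.
rewrite unlock le_eqVlt; apply/orP; left; apply/eqP.
apply: (congr1 (poweR^~ _)); apply: eq_integral => x _ /=.
by rewrite !normrM powRM// !(ger0_norm (powR_ge0 _ _)).
Qed.

Variables (D : set T) (mD : measurable D).

(** Hoelder's inequality on a subset, by extending both functions by zero. *)
Lemma hoelder_on (u w : T -> R) (p q : R) :
  measurable_fun D u -> measurable_fun D w -> (forall x, D x -> 0 <= u x) ->
  0 < p -> 0 < q -> p^-1 + q^-1 = 1 ->
  (\int[mu]_(x in D) (u x * `|w x|)%:E <=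
   (\int[mu]_(x in D) (u x `^ p)%:E) `^ p^-1 *
   'N[mu]_(q%:E)[EFin \o (w \_ D)%R])%E.
Proof.
move=> mu_ mw u0 p0 q0 pq.
have := hoelder mu ((measurable_restrictT _ mD).1 mu_)
  ((measurable_restrictT _ mD).1 mw) p0 q0 pq.
rewrite Lnorm1; congr (_ <= _ * _)%E.
  rewrite [RHS]integral_mkcond; apply: eq_integral => x _ /=.
  rewrite /patch; case: ifPn; rewrite ?inE => Dx /=; last first.
    by rewrite mul0r normr0.
  by rewrite normrM (ger0_norm (u0 _ Dx)).
rewrite unlock; apply: (congr1 (poweR^~ _)).
rewrite [RHS]integral_mkcond; apply: eq_integral => x _ /=.
rewrite /patch; case: ifPn; rewrite ?inE => Dx /=.
  by rewrite (ger0_norm (u0 _ Dx)).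
by rewrite normr0 powR0 ?gt_eqF.
Qed.

End hoelder_on_a_set.

(** The pair of exponents 1, +oo.  The trivial exponents 1 are kept so that the
    conclusion has the form required by [korkine_hoelder_bound]. *)
Lemma hoelder_on_ess_bounded d (T : measurableType d) (R : realType)
    (mu : {measure set T -> \bar R}) (D : set T) (u w : T -> R) (M : R) :
  measurable D -> measurable_fun D u -> measurable_fun D w ->
  (forall x, D x -> 0 <= u x) -> 0 <= M ->
  {ae mu, forall x, D x -> `|w x| <= M} ->
  (\int[mu]_(x in D) (u x * `|w x|)%:E <=
   (\int[mu]_(x in D) (u x `^ 1)%:E) `^ 1^-1 * M%:E)%E.
Proof.
move=> mD mu_ mw u0 M0 wM.
have -> : (\int[mu]_(x in D) (u x `^ 1)%:E = \int[mu]_(x in D) (u x)%:E)%E.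
  by apply: eq_integral => x /[!inE] Dx; rewrite powRr1// u0.
have iu0 : (0 <= \int[mu]_(x in D) (u x)%:E)%E.
  by apply: integral_ge0 => x Dx; rewrite lee_fin u0.
rewrite invr1 poweRe1// muleC -ge0_integralZl_EFin//; last first.
  exact/measurable_EFinP.
apply: ae_ge0_le_integral => //.
- by move=> x Dx; rewrite lee_fin mulr_ge0// u0.
- apply/measurable_EFinP; apply: measurable_funM => //.
  exact: measurableT_comp.
- by move=> x Dx; rewrite -EFinM lee_fin mulr_ge0// u0.
- by apply/measurable_EFinP; exact: measurable_funM.
- apply: filterS wM => x /= wM Dx.
  by rewrite lee_fin mulrC ler_wpM2r ?u0// wM.
Qed.

(** * Square integrability on a bounded interval *)

Lemma integrable_mul_sqr d (T : measurableType d) (R : realType)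
    (mu : {measure set T -> \bar R}) (D : set T) (u v : T -> R) :
  measurable D -> measurable_fun D u -> measurable_fun D v ->
  mu.-integrable D (EFin \o (fun x => u x ^+ 2)) ->
  mu.-integrable D (EFin \o (fun x => v x ^+ 2)) ->
  mu.-integrable D (EFin \o (fun x => u x * v x)).
Proof.
move=> mD mu_ mv iu iv; apply: le_integrable (integrableD mD iu iv) => //.
  by apply/measurable_EFinP; exact: measurable_funM.
move=> x _ /=; rewrite lee_fin normrM.
rewrite (ger0_norm (addr_ge0 (sqr_ge0 _) (sqr_ge0 _))).
rewrite -[u x ^+ 2]real_normK ?num_real// -[v x ^+ 2]real_normK ?num_real//.
move: `|u x| `|v x| => y z; have := sqr_ge0 y; have := sqr_ge0 z.
by have := sqr_ge0 (y - z); rewrite sqrrB; lra.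
Qed.

Lemma leb_itvcc (R : realType) (a b : R) : a < b ->
  leb (`[a, b] : set (lebesgueType R)) = (b - a)%:E.
Proof.
move=> ab; rewrite -[LHS]/(@lebesgue_measure R `[a, b]).
by rewrite lebesgue_measure_itv/= lte_fin ab.
Qed.

Lemma integrable_cst_itvcc (R : realType) (a b c : R) : a < b ->
  leb.-integrable (`[a, b] : set (lebesgueType R)) (cst c%:E).
Proof.
move=> ab; have mD := borel_lebesgue_measurable (measurable_itv `[a, b]).
apply/integrableP; split; first exact: measurable_cst.
by rewrite integral_cst//= leb_itvcc// ltry.
Qed.

Lemma in_Lp_measurable (R : realType) (a b : R) p (f : R -> R) :
  in_Lp a b p f -> measurable_on a b f.
Proof.
move=> /sub_Lfun_mfun; rewrite inE => mf.
by apply/(measurable_restrictT _ _) => //; exact: borel_lebesgue_measurable.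
Qed.

Lemma in_Lp_norm (R : realType) (a b : R) p (f : R -> R) : in_Lp a b p f ->
  ('N[leb]_p[EFin \o (f \_ `[a, b] : lebesgueType R -> R)] =
   (norm_Lp a b p f)%:E)%E.
Proof.
move=> /sub_Lfun_finLfun; rewrite inE /finite_norm => ff.
by rewrite /norm_Lp fineK// ge0_fin_numE// Lnorm_ge0.
Qed.

Lemma norm_Lp_ge0 (R : realType) (a b : R) p (f : R -> R) :
  0 <= norm_Lp a b p f.
Proof. by rewrite fine_ge0// Lnorm_ge0. Qed.

(** The essential supremum norm is defined to be 0 for the zero measure, hence
    the appeal to the positive measure of the line. *)
Lemma in_Ly_ae_le (R : realType) (a b : R) (f : R -> R) : a < b ->
  in_Lp a b +oo f ->
  {ae leb, forall x : lebesgueType R, `[a, b]%classic x ->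
    `|f x| <= norm_Lp a b +oo f}.
Proof.
move=> ab ff; have := in_Lp_norm ff; rewrite unlock.
have leb_gt0 : (0 < leb [set: lebesgueType R])%E.
  apply: (@lt_le_trans _ _ (leb (`[a, b] : set (lebesgueType R)))).
    by rewrite leb_itvcc// lte_fin subr_gt0.
  by apply: le_measure; rewrite ?inE//; exact: borel_lebesgue_measurable.
rewrite leb_gt0 => Nf.
have := ess_sup_ge leb (abse \o (EFin \o (f \_ `[a, b] : lebesgueType R -> R))).
rewrite Nf; apply: filterS => x /= + Dx.
by rewrite patchE mem_set.
Qed.

(** On a set of finite measure, L^p is contained in L^2 for p >= 2: a square is
    at most [1 + |f| ^ p] for finite p, and essentially bounded for p = +oo. *)
Lemma in_Lp_sqr_integrable (R : realType) (a b : R) (p : \bar R)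
    (f : R -> R) : a < b -> (2%:E <= p)%E -> in_Lp a b p f ->
  leb.-integrable (`[a, b] : set (lebesgueType R))
    (EFin \o (fun x => f x ^+ 2)).
Proof.
move=> ab p2 ff.
have mD := borel_lebesgue_measurable (measurable_itv `[a, b]).
have mf := in_Lp_measurable ff.
have mf2 : measurable_fun (`[a, b] : set (lebesgueType R))
    (EFin \o (fun x => f x ^+ 2)).
  by apply/measurable_EFinP; exact: measurable_funX.
move: p p2 ff => [p| |]//.
- rewrite lee_fin => p2 ff.
  have p1 : 1 <= p by lra.
  have i1 := integrable_cst_itvcc 1 ab.
  have ip := integrableS measurableT mD (@subsetT _ _) (Lfun_integrable p1 ff).
  apply: le_integrable (integrableD mD i1 ip) => //.
  move=> x Dx /=; rewrite lee_fin patchE mem_set//.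
  rewrite ger0_norm ?sqr_ge0// ger0_norm ?addr_ge0 ?powR_ge0//.
  have [f1|f1] := leP 1 `|f x|.
    rewrite -[f x ^+ 2]real_normK ?num_real// -powR_mulrn//.
    by rewrite (le_trans (ler_powR f1 p2))// lerDr.
  rewrite (@le_trans _ _ 1)// ?lerDl ?powR_ge0//.
  by rewrite -[f x ^+ 2]real_normK ?num_real// expr_le1// ltW.
- move=> _ ff; have fM := in_Ly_ae_le ab ff.
  have [_ i1] := integrableP _ _ _
    (integrable_cst_itvcc (norm_Lp a b +oo f ^+ 2) ab).
  apply/integrableP; split => //; apply: le_lt_trans i1.
  apply: ae_ge0_le_integral.
  + exact: mD.
  + by move=> x _; rewrite abse_ge0.
  + exact: measurableT_comp.
  + by move=> x _; rewrite abse_ge0.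
  + exact: measurable_cst.
  + apply: filterS fM => x /= fM Dx; rewrite lee_fin.
    by rewrite !normrX ler_pXn2r ?nnegrE// (le_trans (fM Dx))// ler_norm.
Qed.

(** * The functional under Hoelder conditions *)

Section pompeiu_chebyshev_bounds.
Variables (R : realType) (a b : R) (f g h : R -> R) (p q H1 H2 : R).
Hypotheses (ab : a < b) (p0 : 0 < p) (q0 : 0 < q).
Hypotheses (H1_ge0 : 0 <= H1) (H2_ge0 : 0 <= H2).
Hypotheses (mf : measurable_on a b f) (mg : measurable_on a b g)
  (mh : measurable_on a b h).
Hypotheses (f0 : forall s, s \in `[a, b] -> f s != 0)
  (g0 : forall s, s \in `[a, b] -> g s != 0).
Hypotheses (hf : holder_on a b p H1 (fun x => h x / f x))
  (hg : holder_on a b q H2 (fun x => h x / g x)).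

Local Notation D := (`[a, b]%classic : set (lebesgueType R)).

Let mD : measurable D.
Proof. exact: borel_lebesgue_measurable. Qed.

Hypotheses (iff2 : leb.-integrable D (EFin \o (fun x => f x ^+ 2)))
  (igg2 : leb.-integrable D (EFin \o (fun x => g x ^+ 2))).

(** A Hoelder function on a bounded interval is bounded; this makes [h] as
    integrable as [f]. *)
Lemma holder_ratio_bounded x : x \in `[a, b] ->
  `|h x| <= (`|h a / f a| + H1 * (b - a) `^ p) * `|f x|.
Proof.
move=> xab; have aab : a \in `[a, b] by rewrite in_itv/= lexx ltW.
have -> : h x = (h a / f a + (h x / f x - h a / f a)) * f x.
  by rewrite addrC subrK divfK// f0.
rewrite normrM ler_wpM2r// (le_trans (ler_normD _ _))// lerD2l.
rewrite (le_trans (hf xab aab))// ler_wpM2l// ge0_ler_powR ?nnegrE ?(ltW p0)//.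
  by rewrite subr_ge0 ltW.
move: xab; rewrite in_itv/= => /andP[ax xb].
by rewrite ger0_norm ?subr_ge0// lerD2r.
Qed.

Let ihh : leb.-integrable D (EFin \o (fun x => h x ^+ 2)).
Proof.
set M := `|h a / f a| + H1 * (b - a) `^ p.
apply: (le_integrable mD _ _ (integrableZl mD (M ^+ 2) iff2)).
  by apply/measurable_EFinP; exact: measurable_funX.
move=> x Dx; rewrite -EFinM lee_fin -exprMn !normrX ler_pXn2r ?nnegrE//.
rewrite (le_trans (holder_ratio_bounded Dx))// [leRHS]normrM.
by rewrite ler_wpM2r// ler_norm.
Qed.

Let ifg := integrable_mul_sqr mD mf mg iff2 igg2.
Let ifh := integrable_mul_sqr mD mf mh iff2 ihh.
Let ihg := integrable_mul_sqr mD mh mg ihh igg2.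

Let k (x t : R) : R := `|x - t| `^ (p + q).

Let k_ge0 (x t : R) : 0 <= k x t.
Proof. exact: powR_ge0. Qed.

Let measurable_k x : measurable_fun D (k x).
Proof.
rewrite (_ : k x = fun t => `|t - x| `^ (p + q)); last first.
  by apply/funext => t; rewrite /k distrC.
by apply: measurable_fun_lebesgue => //; exact: measurable_dist_powR.
Qed.

Lemma holder_ratio_kernel x t : x \in `[a, b] -> t \in `[a, b] ->
  `|(h x * f t - h t * f x) * (h x * g t - h t * g x)| <=
  `|f x * g x| * (H1 * H2 * k x t * `|f t * g t|).
Proof.
move=> xab tab.
have -> : (h x * f t - h t * f x) * (h x * g t - h t * g x) =
    (h x / f x - h t / f t) * (h x / g x - h t / g t) *
    ((f x * g x) * (f t * g t)).
  by field; rewrite !f0 ?g0.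
rewrite /k powRD; last by rewrite gt_eqF// addr_gt0.
rewrite normrM [X in _ * X <= _]normrM.
have -> : `|f x * g x| * (H1 * H2 * (`|x - t| `^ p * `|x - t| `^ q) *
    `|f t * g t|) = (H1 * `|x - t| `^ p) * (H2 * `|x - t| `^ q) *
    (`|f x * g x| * `|f t * g t|) by ring.
by rewrite ler_wpM2r ?mulr_ge0// normrM ler_pM// ?hf ?hg.
Qed.

(** The common core of the cases (i) and (ii), with the constant that two
    applications of Hoelder's inequality yield. *)
Lemma pompeiu_chebyshev_le_hoelder (al W : R) : 0 < al -> 0 <= W ->
  (forall u : lebesgueType R -> R, measurable_fun D u ->
    (forall x, D x -> 0 <= u x) ->
    (\int[leb]_(x in D) (u x * `|f x * g x|)%:E <=
     (\int[leb]_(x in D) (u x `^ al)%:E) `^ al^-1 * W%:E)%E) ->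
  2 * `|pompeiu_chebyshev a b h f g| <= H1 * H2 *
    (2 * (b - a) `^ (al * (p + q) + 2) /
     ((al * (p + q) + 1) * (al * (p + q) + 2))) `^ al^-1 * W ^+ 2.
Proof.
move=> al0 W0 hol.
have s0 : 0 < p + q by rewrite addr_gt0.
set r := al * (p + q); have r0 : 0 < r by rewrite mulr_gt0.
have r1 : 0 < r + 1 by rewrite addr_gt0.
pose J (x : R) := ((x - a) `^ (r + 1) + (b - x) `^ (r + 1)) / (r + 1).
have J0 x : 0 <= J x by rewrite divr_ge0 ?addr_ge0 ?powR_ge0// ltW.
have mJ : measurable_fun D J.
  apply: measurable_fun_lebesgue; first exact: measurable_itv.
  apply: measurable_funTS; apply: measurable_funM; last exact: measurable_cst.
  apply: measurable_funD.
    by apply: (measurableT_comp (measurable_powR _)); exact: measurable_funB.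
  by apply: (measurableT_comp (measurable_powR _)); exact: measurable_funB.
have kJ x : D x -> (\int[leb]_(t in D) (k x t `^ al)%:E <= (J x)%:E)%E.
  move=> Dx; rewrite le_eqVlt; apply/orP; left; apply/eqP.
  have axb : a <= x <= b by move: Dx; rewrite /= in_itv.
  rewrite -(integral_dist_powR axb r0).
  by apply: eq_integral => t _; rewrite /k -powRrM [in RHS]/r mulrC.
have C0 : 0 <= H1 * H2 by rewrite mulr_ge0.
have := @korkine_hoelder_bound _ _ R leb D mD f g h ifg ifh ihg ihh k J
  (H1 * H2) al W C0 al0 W0 (fun x t _ _ => k_ge0 x t)
  (fun x _ => measurable_k x) holder_ratio_kernel mJ (fun x _ => J0 x) kJ hol.
rewrite integral2_dist_powR ?(ltW ab)// poweR_EFin -!EFinM lee_fin.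
move=> /le_trans; apply; rewrite le_eqVlt; apply/orP; left; apply/eqP.
by ring.
Qed.

Lemma pompeiu_chebyshev_le_sup (W : R) : 0 <= W ->
  (\int[leb]_(x in D) `|f x * g x|%:E <= W%:E)%E ->
  2 * `|pompeiu_chebyshev a b h f g| <=
    H1 * H2 * (b - a) `^ (p + q) * W ^+ 2.
Proof.
move=> W0 fgW.
have s0 : 0 < p + q by rewrite addr_gt0.
have C0 : 0 <= H1 * H2 by rewrite mulr_ge0.
have kL x t : D x -> D t -> 0 <= k x t <= (b - a) `^ (p + q).
  rewrite /= !in_itv/= => /andP[ax xb] /andP[at_ tb]; rewrite k_ge0/=.
  rewrite ge0_ler_powR ?nnegrE ?(ltW s0)// ?subr_ge0 ?(ltW ab)//.
  by rewrite ler_norml; apply/andP; split; lra.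
exact: (@korkine_sup_bound _ _ R leb D mD f g h ifg ifh ihg ihh k
  (H1 * H2) ((b - a) `^ (p + q)) W C0 kL (fun x _ => measurable_k x)
  holder_ratio_kernel fgW W0 (powR_ge0 _ _)).
Qed.

End pompeiu_chebyshev_bounds.

(** * The three estimates *)

Lemma Lnorm_mul_itvcc (R : realType) (a b c : R) (f g : R -> R) : 0 < c ->
  in_Lp a b (2 * c)%:E f -> in_Lp a b (2 * c)%:E g ->
  ('N[leb]_(c%:E)[EFin \o
     ((fun x => f x * g x)%R \_ `[a, b] : lebesgueType R -> R)] <=
   (norm_Lp a b (2 * c)%:E f * norm_Lp a b (2 * c)%:E g)%:E)%E.
Proof.
move=> c0 ff gg.
have mr e (u : R -> R) : in_Lp a b e u ->
    measurable_fun setT (u \_ `[a, b] : lebesgueType R -> R).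
  by move=> /sub_Lfun_mfun; rewrite inE.
have := Lnorm_mul_le leb c0 (mr _ _ ff) (mr _ _ gg).
rewrite (in_Lp_norm ff) (in_Lp_norm gg) -EFinM; apply: le_trans.
rewrite le_eqVlt; apply/orP; left; apply/eqP; apply: eq_Lnorm => x /=.
by rewrite !patchE; case: ifPn => //; rewrite mulr0.
Qed.

(** AM-GM for the two pairs of factors [2 x + 1], [2 y + 1] and [2 x + 2],
    [2 y + 2], whose means are [x + y + 1] and [x + y + 2]. *)
Lemma holder_constant_le (R : realType) (x y : R) : 0 <= x -> 0 <= y ->
  (2 * x + 1) * (2 * x + 2) * (2 * y + 1) * (2 * y + 2) <=
  ((x + y + 1) * (x + y + 2)) ^+ 2.
Proof.
move=> x0 y0.
have e1 : (2 * x + 1) * (2 * y + 1) <= (x + y + 1) ^+ 2.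
  by have := sqr_ge0 (x - y); nra.
have e2 : (2 * x + 2) * (2 * y + 2) <= (x + y + 2) ^+ 2.
  by have := sqr_ge0 (x - y); nra.
have -> : (2 * x + 1) * (2 * x + 2) * (2 * y + 1) * (2 * y + 2) =
  (2 * x + 1) * (2 * y + 1) * ((2 * x + 2) * (2 * y + 2)) by ring.
rewrite exprMn.
by apply: ler_pM => //; apply: mulr_ge0; lra.
Qed.

Theorem theorem9 (R : realType) (a b : R) (hab : a < b) (f g h : R -> R)
  (mf : measurable_on a b f) (mg : measurable_on a b g)
  (mh : measurable_on a b h)
  (f0 : forall s, s \in `[a, b] -> f s != 0)
  (g0 : forall s, s \in `[a, b] -> g s != 0)
  (p q : R) (p0 : 0 < p) (p1 : p <= 1) (q0 : 0 < q) (q1 : q <= 1)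
  (H1 H2 : R) (H1_gt0 : 0 < H1) (H2_gt0 : 0 < H2)
  (hf : holder_on a b p H1 (fun x => h x / f x))
  (hg : holder_on a b q H2 (fun x => h x / g x))
  (alpha beta : R) (alpha1 : 1 < alpha) (ab1 : alpha^-1 + beta^-1 = 1) :
  (in_Lp a b +oo%E f -> in_Lp a b +oo%E g ->
   `|pompeiu_chebyshev a b h f g| <=
     H1 * H2 *
     ((b - a) `^ (p + q + 2) /
      Num.sqrt ((2 * p + 1) * (2 * p + 2) * (2 * q + 1) * (2 * q + 2))) *
     norm_Lp a b +oo%E f ^+ 2 * norm_Lp a b +oo%E g ^+ 2) /\
  (in_Lp a b (2 * beta)%:E f -> in_Lp a b (2 * beta)%:E g ->
   `|pompeiu_chebyshev a b h f g| <=
     H1 * H2 *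
     ((2 `^ (- beta^-1) * (b - a) `^ (p + q + 2 / alpha)) /
      ((2 * alpha * p + 1) * (2 * alpha * p + 2) *
       (2 * alpha * q + 1) * (2 * alpha * q + 2)) `^ (1 / (2 * alpha))) *
     norm_Lp a b (2 * beta)%:E f ^+ 2 * norm_Lp a b (2 * beta)%:E g ^+ 2) /\
  (in_Lp a b 2%:E f -> in_Lp a b 2%:E g ->
   `|pompeiu_chebyshev a b h f g| <=
     1 / 2 * H1 * H2 * (b - a) `^ (p + q) *
     norm_Lp a b 2%:E f ^+ 2 * norm_Lp a b 2%:E g ^+ 2).
Proof.
have mD := borel_lebesgue_measurable (measurable_itv `[a, b]).
have H1_ge0 := ltW H1_gt0; have H2_ge0 := ltW H2_gt0.
have C_ge0 : 0 <= H1 * H2 by rewrite mulr_ge0.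
have al0 : 0 < alpha by lra.
have L0 : 0 < b - a by rewrite subr_gt0.
have mfg : measurable_fun (`[a, b] : set (lebesgueType R)) (fun x => f x * g x).
  exact: measurable_funM.
have W_ge0 e : 0 <= norm_Lp a b e f * norm_Lp a b e g.
  by rewrite mulr_ge0 ?norm_Lp_ge0.
split; [|split] => fL gL.
- set F := norm_Lp a b +oo f; set G := norm_Lp a b +oo g.
  have i2 := in_Lp_sqr_integrable hab (leey _).
  have fgM : {ae leb, forall x : lebesgueType R, `[a, b]%classic x ->
      `|f x * g x| <= F * G}.
    apply: filterS2 (in_Ly_ae_le hab fL) (in_Ly_ae_le hab gL) => x fF gG Dx.
    by rewrite normrM ler_pM// ?fF ?gG.
  have := @pompeiu_chebyshev_le_hoelder R a b f g h p q H1 H2 hab p0 q0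
    H1_ge0 H2_ge0 mf mg mh f0 g0 hf hg (i2 _ fL) (i2 _ gL) 1 (F * G) ltr01
    (W_ge0 _) (fun u mu_ u0 =>
      hoelder_on_ess_bounded mD mu_ mfg u0 (W_ge0 _) fgM).
  rewrite !mul1r invr1 powRr1; last first.
    by rewrite divr_ge0 ?mulr_ge0 ?powR_ge0 ?addr_ge0// ltW.
  set s := p + q; set X := (2 * p + 1) * _ * _ * _.
  have s0 : 0 < s by rewrite addr_gt0.
  have X0 : 0 < X by rewrite !mulr_gt0 ?addr_gt0 ?mulr_gt0.
  have Z0 : 0 < (s + 1) * (s + 2) by rewrite mulr_gt0 ?addr_gt0.
  have XZ : Num.sqrt X <= (s + 1) * (s + 2).
    rewrite -[leRHS](@ger0_norm R) ?(ltW Z0)// -sqrtr_sqr ler_sqrt ?sqr_ge0//.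
    exact: holder_constant_le (ltW p0) (ltW q0).
  rewrite -mulrA => PX; rewrite -(ler_pM2l (_ : 0 < 2))//.
  apply: (le_trans PX).
  have -> : 2 * (H1 * H2 * ((b - a) `^ (s + 2) / Num.sqrt X) * F ^+ 2 * G ^+ 2)
    = H1 * H2 * (2 * ((b - a) `^ (s + 2) / Num.sqrt X) * (F * G) ^+ 2) by ring.
  rewrite ler_wpM2l// ler_wpM2r ?sqr_ge0// -mulrA ler_wpM2l//.
  rewrite ler_wpM2l ?powR_ge0// lef_pV2// posrE//.
  by rewrite sqrtr_gt0.
- set F := norm_Lp a b _ f; set G := norm_Lp a b _ g.
  have alV1 : alpha^-1 < 1 by rewrite invf_lt1.
  have betaV0 : 0 < beta^-1 by lra.
  have beta0 : 0 < beta by rewrite -invr_gt0.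
  have beta1 : 1 <= beta.
    have alV0 : 0 < alpha^-1 by rewrite invr_gt0.
    by rewrite -(invrK beta) invf_ge1//; lra.
  have b2 : (2%:E <= (2 * beta)%:E)%E by rewrite lee_fin; lra.
  have i2 := in_Lp_sqr_integrable hab b2.
  have fgW := Lnorm_mul_itvcc beta0 fL gL.
  have hol (u : lebesgueType R -> R) :
      measurable_fun (`[a, b] : set (lebesgueType R)) u ->
      (forall x, `[a, b]%classic x -> 0 <= u x) ->
      (\int[leb]_(x in `[a, b]) (u x * `|f x * g x|)%:E <=
       (\int[leb]_(x in `[a, b]) (u x `^ alpha)%:E) `^ alpha^-1 *
       (F * G)%:E)%E.
    move=> mu_ u0.
    apply: (le_trans (hoelder_on leb mD mu_ mfg u0 al0 beta0 ab1)).
    by rewrite lee_wpmul2l// poweR_ge0.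
  have := pompeiu_chebyshev_le_hoelder hab p0 q0 H1_ge0 H2_ge0 mf mg mh f0 g0
    hf hg (i2 _ fL) (i2 _ gL) al0 (W_ge0 _) hol.
  set s := p + q; set Z := (alpha * s + 1) * (alpha * s + 2).
  set Y := (2 * alpha * p + 1) * (2 * alpha * p + 2) * _ * _.
  have Z0 : 0 < Z by rewrite mulr_gt0 ?addr_gt0 ?mulr_gt0 ?addr_gt0.
  have Y0 : 0 < Y by rewrite !mulr_gt0 ?addr_gt0 ?mulr_gt0.
  have YZ : Y `^ (1 / (2 * alpha)) <= Z `^ alpha^-1.
    (* Squaring Z halves the exponent and allows the AM-GM comparison with Y. *)
    have -> : Z `^ alpha^-1 = (Z ^+ 2) `^ (1 / (2 * alpha)).
      rewrite -powR_mulrn ?(ltW Z0)// -powRrM; congr (_ `^ _).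
      by field; rewrite gt_eqF.
    have e0 : 0 <= 1 / (2 * alpha) by rewrite divr_ge0 ?mulr_ge0 ?(ltW al0).
    rewrite (ge0_ler_powR e0) ?nnegrE ?(ltW Y0) ?sqr_ge0//.
    have := holder_constant_le (ltW (mulr_gt0 al0 p0)) (ltW (mulr_gt0 al0 q0)).
    by congr (_ <= _); rewrite /Y /Z /s; ring.
  (* Conjugacy: 1 / alpha = 1 - 1 / beta. *)
  have two : 2 `^ alpha^-1 = 2 * 2 `^ (- beta^-1) :> R.
    rewrite -{2}[2](@powRr1 R)// -powRD; last by rewrite pnatr_eq0 implybT.
    by congr (_ `^ _); lra.
  have L2 : ((b - a) `^ (alpha * s + 2)) `^ alpha^-1 =
      (b - a) `^ (s + 2 / alpha).
    by rewrite -powRrM; congr (_ `^ _); field; rewrite gt_eqF.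
  have ZV : Z^-1 `^ alpha^-1 = (Z `^ alpha^-1)^-1.
    by rewrite -[Z^-1]powR_inv1 ?(ltW Z0)// powRAC powR_inv1 ?powR_ge0.
  rewrite powRM ?mulr_ge0 ?powR_ge0 ?invr_ge0 ?(ltW Z0)//.
  rewrite powRM ?powR_ge0// L2 two ZV => PX.
  rewrite -(ler_pM2l (_ : 0 < 2))//; apply: (le_trans PX).
  set V := 2 `^ _ * _; set E := 2 `^ _.
  have -> : 2 * (H1 * H2 * (V / Y `^ (1 / (2 * alpha))) * F ^+ 2 * G ^+ 2) =
    H1 * H2 * (2 * V / Y `^ (1 / (2 * alpha)) * (F * G) ^+ 2) by ring.
  rewrite -mulrA ler_wpM2l// ler_wpM2r ?sqr_ge0// -[2 * E * _]mulrA.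
  rewrite ler_wpM2l ?mulr_ge0 ?powR_ge0// lef_pV2// posrE powR_gt0//.
- set F := norm_Lp a b _ f; set G := norm_Lp a b _ g.
  have i2 := in_Lp_sqr_integrable hab (lexx 2%:E).
  have fgW : (\int[leb]_(x in (`[a, b] : set (lebesgueType R)))
      `|f x * g x|%:E <= (F * G)%:E)%E.
    have := @Lnorm_mul_itvcc R a b 1 f g ltr01; rewrite mulr1.
    move=> /(_ fL gL); rewrite Lnorm1; apply: le_trans.
    rewrite [leLHS]integral_mkcond le_eqVlt; apply/orP; left; apply/eqP.
    apply: eq_integral => x _ /=; rewrite !patchE.
    by case: ifPn => //; rewrite normr0.
  have := pompeiu_chebyshev_le_sup hab p0 q0 H1_ge0 H2_ge0 mf mg mh f0 g0 hf hg
    (i2 _ fL) (i2 _ gL) (W_ge0 2%:E) fgW.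
  rewrite -/F -/G => PX; rewrite -(ler_pM2l (_ : 0 < 2))//.
  apply: (le_trans PX); rewrite le_eqVlt; apply/orP; left; apply/eqP.
  by field.
Qed.
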